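(* Let $V$ be a finite-dimensional complex vector space and $V_{\mathbb R}\subset V$ a real form of $V$. (a) For every subset $X\subset V_{\mathbb R}$, we have $\mathcal{AC}_{\mathbb R}(X)\subset\mathcal{AC}(X)$. (b) Let $X\subset V_{\mathbb R}$. For every $z\in V_{\mathbb R}\setminus\{0\}$, the following conditions are equivalent: (i) $z\in\mathcal{AC}_{\mathbb R}(X)$; (ii) there are sequences $\{\nu_n\}_{n\ge1}\subset(0,+\infty)$ converging to $0$ and $\{x_n\}_{n\ge 1}\subset X$ such that $z=\lim_{n\to+\infty}\nu_nx_n$; (iii) for every open (positive) cone $\Gamma\subset V_{\mathbb R}$ which contains $z$, the intersection $\Gamma\cap X$ is unbounded. In particular, $\mathrm{AC}(X)=\mathcal{AC}_{\mathbb R}(X)$.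
   Context: Complex asymptotic cone: consider $\iota:V\to\mathbb P(V\oplus\mathbb C)$, $v\mapsto[v\oplus1]$; $\kappa:\mathbb P(V)\to\mathbb P(V\oplus\mathbb C)$, $[v]\mapsto[v\oplus0]$; and $\pi:V\setminus\{0\}\to\mathbb P(V)$, $v\mapsto[v]$, the projective spaces carrying the Zariski topology. For $X\subset V$ put $\mathcal{AC}^{\mathrm p}(X)=\overline{\iota(X)}\cap\kappa(\mathbb P(V))$ (Zariski closure) and $$\mathcal{AC}(X)=\{0\}\cup\pi^{-1}(\kappa^{-1}(\mathcal{AC}^{\mathrm p}(X))).$$ Real asymptotic cone: for a real vector space $W$ let $\mathbb S(W)=(W\setminus\{0\})/\mathbb R_{>0}$, with the quotient of the analytic (Euclidean) topology. Let $\iota^+:V_{\mathbb R}\to\mathbb S(V_{\mathbb R}\oplus\mathbb R)$, $v\mapsto[v\oplus 1]$, let $\pi^+:V_{\mathbb R}\setminus\{0\}\to\mathbb S(V_{\mathbb R})$ be the canonical surjection, and regard $\mathbb S(V_{\mathbb R})\subset\mathbb S(V_{\mathbb R}\oplus\mathbb R)$ via $[v]\mapsto[v\oplus0]$. For $X\subset V_{\mathbb R}$ put $$\mathcal{AC}_{\mathbb R}(X)=\{0\}\cup(\pi^+)^{-1}\big(\mathbb S(V_{\mathbb R})\cap\overline{\iota^+(X)}\big).$$ The asymptotic cone of Harris–He–Ólafsson of $X\subset V_{\mathbb R}$ is $$\mathrm{AC}(X)=\{z\in V_{\mathbb R}\mid \Gamma\text{ an open cone containing }z\Rightarrow\Gamma\cap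 X\text{ is unbounded}\}\cup\{0\}.$$ Here a (positive) cone is a subset of $V_{\mathbb R}$ stable under multiplication by positive reals. *)

(* Defs.v *)
From HB Require Import structures.
From mathcomp Require Import -(notations) mpoly.
From mathcomp Require Import all_boot all_order all_algebra.
From mathcomp Require Import generic_quotient.
From mathcomp Require Import all_classical all_reals all_analysis.
From mathcomp Require Import complex.

Set Implicit Arguments.
Unset Strict Implicit.
Unset Printing Implicit Defensive.

Import Order.TTheory GRing.Theory Num.Theory.
Import numFieldNormedType.Exports.

Local Open Scope classical_set_scope.
Local Open Scope ring_scope.
Local Open Scope quotient_scope.

Notation nonzero U := (set_type [set~ (0 : U)]).

Lemma pair1_nonzero (K : nzRingType) (U : zmodType) (v : U) :
  (v, 1 : K^o) \in [set~ (0 : U * K^o)].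
Proof. by apply/mem_set => -[_ /eqP]; rewrite oner_eq0. Qed.

Lemma pair0_nonzero (K : nzRingType) (U : zmodType) (v : nonzero U) :
  (val v, 0 : K^o) \in [set~ (0 : U * K^o)].
Proof. by apply/mem_set => -[v0]; apply: (set_mem (valP v)). Qed.

Definition pair1 (K : nzRingType) (U : zmodType) (v : U) :
  nonzero (U * K^o)%type := exist _ (v, 1 : K^o) (pair1_nonzero K v).
Definition pair0 (K : nzRingType) (U : zmodType) (v : nonzero U) :
  nonzero (U * K^o)%type := exist _ (val v, 0 : K^o) (pair0_nonzero K v).

Section Projective.
Variables (K : fieldType) (V : vectType K).

Definition same_line (u v : nonzero V) : bool :=
  `[< exists2 t : K, t != 0 & val v = t *: val u >].

Lemma same_line_refl : reflexive same_line.
Proof. by move=> u; apply/asboolP; exists 1; rewrite ?oner_neq0 ?scale1r. Qed.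

Lemma same_line_sym : symmetric same_line.
Proof.
move=> u v; apply/asboolP/asboolP => -[t t0 ->]; exists t^-1;
  by rewrite ?invr_eq0 // scalerA mulVf // scale1r.
Qed.

Lemma same_line_trans : transitive same_line.
Proof.
move=> v u w /asboolP[s s0 vE] /asboolP[t t0 wE]; apply/asboolP.
by exists (t * s); rewrite ?mulf_neq0 // wE vE scalerA.
Qed.

Canonical same_line_equiv :=
  EquivRel same_line same_line_refl same_line_sym same_line_trans.

Definition proj : Type := {eq_quot same_line}.
HB.instance Definition _ := Choice.on proj.
HB.instance Definition _ := EqQuotient.on proj.

Definition proj_class (v : nonzero V) : proj := \pi_proj v.

(* The zero loci of sets of homogeneous polynomials do not depend on the *)
(* basis of V used to evaluate polynomials.                              *)
Definition coord_poly : Type := mpoly (\dim {:V}) K.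

Definition poly_eval (p : coord_poly) (v : V) : K :=
  meval (fun i => coord (vbasis {:V}) i v) p.

Definition homogeneous (p : coord_poly) : Prop :=
  exists d : nat, p \is ishomog1 d mdeg.

Definition zero_locus (S : set coord_poly) : set proj :=
  [set L | forall p, S p -> forall v, proj_class v = L ->
     poly_eval p (val v) = 0].

Definition zariski_open (U : set proj) : Prop :=
  exists2 S : set coord_poly, S `<=` homogeneous & ~` U = zero_locus S.

Lemma proj_class_surj (L : proj) : exists v, proj_class v = L.
Proof. by exists (repr L); rewrite /proj_class reprK. Qed.

Lemma zariski_openT : zariski_open [set: proj].
Proof.
exists [set 1].
  by move=> p ->; exists 0%N; exact: dhomog1.
rewrite setCT; apply/seteqP; split=> // L /(_ 1 erefl).
have [v vL] := proj_class_surj L.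
by move=> /(_ v vL) /eqP; rewrite /poly_eval meval1 oner_eq0.
Qed.

Lemma homogeneous_eval_line (p : coord_poly) (u v : nonzero V) :
  homogeneous p -> proj_class u = proj_class v ->
  poly_eval p (val u) = 0 -> poly_eval p (val v) = 0.
Proof.
move=> [d /dhomogP hm] /eqmodP/asboolP[t t0 ->].
suff -> : poly_eval p (t *: val u) = t ^+ d * poly_eval p (val u).
  by move=> ->; rewrite mulr0.
rewrite /poly_eval !mevalE big_distrr /=.
rewrite big_seq [RHS]big_seq; apply: eq_bigr => m mp.
have -> : d = (\sum_i m i)%N by rewrite -mdegE (hm _ mp).
rewrite mulrCA -prodrXr -big_split /=; congr (_ * _).
by apply: eq_bigr => i _; rewrite linearZ exprMn.
Qed.

Lemma zariski_openI : setI_closed zariski_open.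
Proof.
move=> A B [S hS SE] [T hT TE].
exists [set p * q | p in S & q in T].
  move=> _ [p /hS[d hp] [q /hT[e hq] <-]].
  by exists (d + e)%N; exact: dhomogM.
rewrite setCI SE TE; apply/seteqP; split=> L.
  move=> h _ [p Sp [q Tq <-]] v vL; rewrite /poly_eval mevalM.
  case: h => [/(_ p Sp v vL)|/(_ q Tq v vL)]; rewrite /poly_eval => ->.
    by rewrite mul0r.
  by rewrite mulr0.
move=> h; apply: contrapT => /not_orP[nS nT]; apply: nS => p Sp u uL.
apply: contrapT => pu0; apply: nT => q Tq v vL.
have pv0 : poly_eval p (val v) <> 0.
  by move=> /(homogeneous_eval_line (hS _ Sp) (etrans vL (esym uL))).
have /eqP : poly_eval (p * q) (val v) = 0.
  by apply: h vL; exists p => //; exists q.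
by rewrite /poly_eval mevalM mulf_eq0 => /orP[/eqP|/eqP].
Qed.

Lemma zariski_open_bigU (I : Type) (f : I -> set proj) :
  (forall i, zariski_open (f i)) -> zariski_open (\bigcup_i f i).
Proof.
move=> fo; exists [set p | homogeneous p /\
    exists i, ~` f i `<=` zero_locus [set p]] => [p []//|].
apply/seteqP; split=> L.
  move=> nfL p [_ [i fip]]; apply: (fip L) => // fiL.
  by apply: nfL; exists i.
move=> h [i _]; have [S hS SE] := fo i; apply/not_notP.
suff : (~` f i) L by move=> nfi /(_ nfi).
rewrite SE => p Sp; apply: h; split; first exact: hS.
by exists i; rewrite SE => M MS _ ->; exact: MS.
Qed.

HB.instance Definition _ :=
  isOpenTopological.Build proj zariski_openT zariski_openI zariski_open_bigU.

Lemma zariski_closedP (A : set proj) :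
  closed A <-> exists2 S, S `<=` homogeneous & A = zero_locus S.
Proof.
by rewrite -[A in closed A]setCK closedC /open /= /zariski_open setCK.
Qed.

End Projective.

Section ComplexCone.
Variables (K : fieldType) (V : vectType K).

Let P1 := proj (V * K^o)%type.

Definition iota (v : V) : P1 := proj_class (pair1 K v).

(* The representative is irrelevant, see kappaE. *)
Definition kappa (L : proj V) : P1 := proj_class (pair0 K (repr L)).

Lemma kappaE (v : nonzero V) : kappa (proj_class v) = proj_class (pair0 K v).
Proof.
apply/eqmodP/asboolP.
have /eqmodP/asboolP[t t0 vE] : proj_class (repr (proj_class v)) = proj_class v.
  by rewrite /proj_class reprK.
by exists t => //; rewrite /= vE; congr pair; rewrite scaler0.
Qed.

Definition asymptotic_cone_proj (X : set V) : set P1 :=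
  closure (iota @` X) `&` range kappa.

Definition asymptotic_cone (X : set V) : set V :=
  [set 0] `|`
  val @` (@proj_class K V @^-1` (kappa @^-1` asymptotic_cone_proj X)).

End ComplexCone.

Section Sphere.
Variables (R : realType) (W : normedModType R).

Definition same_ray (u v : nonzero W) : bool :=
  `[< exists2 t : R, 0 < t & val v = t *: val u >].

Lemma same_ray_refl : reflexive same_ray.
Proof. by move=> u; apply/asboolP; exists 1; rewrite ?ltr01 ?scale1r. Qed.

Lemma same_ray_sym : symmetric same_ray.
Proof.
move=> u v; apply/asboolP/asboolP => -[t t0 ->]; exists t^-1;
  by rewrite ?invr_gt0 // scalerA mulVf ?gt_eqF // scale1r.
Qed.

Lemma same_ray_trans : transitive same_ray.
Proof.
move=> v u w /asboolP[s s0 vE] /asboolP[t t0 wE]; apply/asboolP.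
by exists (t * s); rewrite ?mulr_gt0 // wE vE scalerA.
Qed.

Canonical same_ray_equiv :=
  EquivRel same_ray same_ray_refl same_ray_sym same_ray_trans.

Definition sphere := quotient_topology {eq_quot same_ray}.
HB.instance Definition _ := Topological.on sphere.
HB.instance Definition _ := Quotient.on sphere.

Definition sphere_class (v : nonzero W) : sphere := \pi_sphere v.

End Sphere.

Section RealCone.
Variables (R : realType) (W : normedModType R).

Let S1 := sphere (W * R^o)%type.

Definition iota_plus (v : W) : S1 := sphere_class (pair1 R v).

(* The representative is irrelevant, see sphere_inclE. *)
Definition sphere_incl (s : sphere W) : S1 := sphere_class (pair0 R (repr s)).

Lemma sphere_inclE (v : nonzero W) :
  sphere_incl (sphere_class v) = sphere_class (pair0 R v).
Proof.
apply/eqmodP/asboolP.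
have /eqmodP/asboolP[t t0 vE] : sphere_class (repr (sphere_class v)) = sphere_class v.
  by rewrite /sphere_class reprK.
by exists t => //; rewrite /= vE; congr pair; rewrite scaler0.
Qed.

Definition real_asymptotic_cone (X : set W) : set W :=
  [set 0] `|`
  val @` (@sphere_class R W @^-1` (sphere_incl @^-1` closure (iota_plus @` X))).

Definition positive_cone (G : set W) : Prop :=
  forall (t : R) (x : W), 0 < t -> G x -> G (t *: x).

Definition hho_asymptotic_cone (X : set W) : set W :=
  [set z | forall G : set W, open G -> positive_cone G -> G z ->
     ~ bounded_set (G `&` X)] `|` [set 0].

End RealCone.

(* The inclusion of a real form into V is an injective R-linear map j with   *)
(* V = j(VR) (+) i j(VR), injectivity being part of uniqueness below. In      *)
(* particular VR is finite-dimensional, so that all norms on it define the    *)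
(* same (Euclidean) topology and the same bounded sets.                       *)
Definition real_form (R : realType) (V : vectType R[i]) (VR : normedModType R)
    (j : {linear VR -> V | real_complex R \; *:%R}) : Prop :=
  forall v : V, exists! p : VR * VR, v = j p.1 + 'i%C *: j p.2.

(* Main.v *)
From HB Require Import structures.
Require Import Defs.
From mathcomp Require Import -(notations) mpoly.
From mathcomp Require Import all_boot all_order all_algebra.
From mathcomp Require Import generic_quotient.
From mathcomp Require Import all_classical all_reals all_analysis.
From mathcomp Require Import complex.

Set Implicit Arguments.
Unset Strict Implicit.
Unset Printing Implicit Defensive.

Import Order.TTheory GRing.Theory Num.Theory.
Import numFieldNormedType.Exports.
Import VectorInternalTheory.

Local Open Scope classical_set_scope.
Local Open Scope ring_scope.

(** Why the statement holds.

Part (b).  The sphere of rays carries the quotient topology, so its open sets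
correspond to the open cones of the ambient space that avoid 0.  Thus
[z (+) 0] lies in the closure of the image of X exactly when every open cone
of the space W (+) R that contains (z, 0) meets X x {1} (lemmas
[sphere_closureP] and [real_asymptotic_coneP]), and the three conditions are
compared through open cones.
- (i) implies (iii): given an open cone G around z and M, the open cone of
  the (v, t) with v in G and M * t < |v| contains (z, 0); a point (x, 1) of it
  with x in X is a point of G and X with norm greater than M.
- (iii) implies (ii): apply (iii) to the open cones generated by the balls of
  radius 1/(n+1) around z.  The scalar that brings a large element of X back
  into the ball is necessarily small.
- (ii) implies (i): (nu_n x_n, nu_n) tends to (z, 0), hence enters every open
  cone around (z, 0), and up to a positive scalar it is (x_n, 1).

Part (a).  Take z = lim nu_n x_n as in (ii).  A homogeneous polynomial p that
vanishes at every (j x, 1) vanishes at (j (nu_n x_n), nu_n), which is on the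
same line as (j x_n, 1).  By continuity it vanishes at (j z, 0), so that
[j z (+) 0] lies in every Zariski closed set containing the image of j X.
Continuity is the one delicate point: the norm of VR is arbitrary and V has
only an algebraic structure, so one needs that linear maps out of a
finite-dimensional normed space are continuous.  The isomorphism of VR (+) VR
with V, a power of the complex numbers, is a linear bijection of VR (+) VR
onto some R^n, and it is continuous by compactness of the unit sphere of R^n
([linear_bij_rV_continuous]); [real_form_cvg] restricts it to VR. *)

Definition nonzero_of (U : zmodType) (v : U) (v0 : v <> 0) : nonzero U :=
  exist (fun u => u \in [set~ 0]) v (mem_set v0).

(** * Closures in the sphere and open cones *)

Section RealCone.
Variable R : realType.

Lemma sphere_class_eqP (W : normedModType R) (u v : nonzero W) :
  sphere_class u = sphere_class v <-> exists2 t : R, 0 < t & val v = t *: val u.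
Proof. by split=> [/eqmodP/asboolP|h]; last by apply/eqmodP/asboolP. Qed.

(** The saturated open sets of W minus the origin are its open cones: for the
quotient topology they are all that a closure has to be tested against. *)
Lemma sphere_closureP (W : normedModType R) (A : set (nonzero W))
    (w : nonzero W) :
  closure (@sphere_class R W @` A) (sphere_class w) <->
  forall N : set W, open N -> positive_cone N -> N (val w) ->
    exists2 a, A a & N (val a).
Proof.
split=> [clA N oN coneN Nw|coneA U].
  pose U : set (sphere W) := [set sphere_class u | u in val @^-1` N].
  have US u : U (sphere_class u) -> N (val u).
    by move=> [v Nv /sphere_class_eqP[t t0 ->]]; exact: coneN.
  have oU : open U.
    exists N => //; apply/seteqP; split=> [u Nu|u /US //]; by exists u.
  have [|_ [[a Aa <-] /US Na]] := clA U; last by exists a.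
  by apply: open_nbhs_nbhs; split=> //; exists w.
rewrite nbhsE => -[U0 [[N oN NE] U0w] U0U].
(* The preimage of U0 is only known as the trace of an open set N on the
   nonzero vectors; removing the origin from N makes it a cone. *)
pose C : set W := [set v | N v /\ v <> 0].
have CP (u : nonzero W) : C (val u) <-> U0 (sphere_class u).
  have -> : U0 (sphere_class u) = N (val u).
    have : (val @^-1` N) u = (\pi_(sphere W)%qT @^-1` U0) u by rewrite NE.
    by move=> /esym.
  by split=> [[]//|Nu]; split=> //; exact: (set_mem (valP u)).
have C0 v : C v -> exists u : nonzero W, val u = v.
  by move=> [_ v0]; exists (nonzero_of v0).
have [|||a Aa /CP U0a] := coneA C.
- rewrite (_ : C = N `&` ~` [set 0]) //; apply: openI => //.
  apply: closed_openC; apply: accessible_closed_set1.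
  exact: hausdorff_accessible (@norm_hausdorff _ _).
- move=> t v t0 Cv; have [u uv] := C0 _ Cv; rewrite -uv in Cv *.
  have tu0 : t *: val u <> 0.
    move=> /eqP; rewrite scaler_eq0 gt_eqF //= => /eqP.
    exact: (set_mem (valP u)).
  pose tu := nonzero_of tu0.
  have /CP : U0 (sphere_class tu); last exact.
  have <- : sphere_class u = sphere_class tu.
    by apply/sphere_class_eqP; exists t.
  exact/CP.
- exact/CP.
by exists (sphere_class a); split; [exists a | exact: U0U].
Qed.

Section Cone.
Variables (W : normedModType R) (X : set W).

Lemma real_asymptotic_coneP (z : W) : z != 0 ->
  real_asymptotic_cone X z <->
  forall N : set (W * R^o), open N -> positive_cone N -> N (z, 0) ->
    exists2 x, X x & N (x, 1).
Proof.
move=> /eqP z0; pose z' := nonzero_of z0.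
have cl : real_asymptotic_cone X z <->
    closure (@sphere_class R (W * R^o)%type @` (@pair1 R W @` X))
      (sphere_class (pair0 R z')).
  rewrite image_comp; split=> [[/z0//|[u clu uz]]|clz].
    have <- : u = z' by exact: val_inj.
    by move: clu => /=; rewrite sphere_inclE.
  by right; exists z' => //=; rewrite sphere_inclE.
apply: (iff_trans cl); apply: (iff_trans (sphere_closureP _ _)).
split=> h N oN cN Nz; have [a] := h N oN cN Nz.
  by move=> [x Xx <-] Nx; exists x.
by move=> Xa Na; exists (pair1 R a) => //; exists a.
Qed.

Lemma unboundedP (A : set W) :
  ~ bounded_set A <-> forall M : R, exists2 x, A x & M < `|x|.
Proof.
split=> [nb M|h [M [_ AM]]].
  apply: contrapT => nM; apply: nb; exists M; split; first exact: num_real.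
  move=> N MN x Ax; apply: le_trans (ltW MN); rewrite leNgt; apply/negP => Mx.
  by apply: nM; exists x.
have [x Ax] := h (M + 1); rewrite ltNge => /negP; apply.
by apply: AM => //; rewrite ltrDl.
Qed.

(** The open cone M * t < |v| contains (z, 0) since z is nonzero, and a point
(x, 1) only if |x| > M. *)
Lemma real_cone_unbounded (z : W) (G : set W) : z != 0 ->
  real_asymptotic_cone X z -> open G -> positive_cone G -> G z ->
  ~ bounded_set (G `&` X).
Proof.
move=> z0 /(real_asymptotic_coneP z0) h oG cG Gz; apply/unboundedP => M.
have [|||x Xx [/= Gx Mx]] := h [set p | G p.1 /\ M * p.2 < `|p.1|].
- rewrite (_ : mkset _ = (fst @^-1` G) `&`
    ((fun p : W * R^o => `|p.1| - M * p.2) @^-1` [set y | 0 < y])).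
    apply: openI; apply: open_comp => //; try exact: open_gt.
      by move=> p _; exact: cvg_fst.
    move=> p _; apply: cvgB; first by apply: cvg_norm; exact: cvg_fst.
    by apply: cvgMl_tmp; exact: cvg_snd.
  by apply/seteqP; split=> p /= []; rewrite subr_gt0.
- move=> t p t0 [/= Gp Mp]; split; first exact: cG.
  by rewrite normrZ gtr0_norm // mulrCA ltr_pM2l.
- by split=> //=; rewrite mulr0 normr_gt0.
by exists x => //; rewrite -[M]mulr1.
Qed.

(** Choosing one point of X in the cone generated by each small ball around z
gives both sequences: nu is the scalar that moves the point into the ball. *)
Lemma unbounded_seq (z : W) :
  (forall G : set W, open G -> positive_cone G -> G z ->
     ~ bounded_set (G `&` X)) ->
  exists (nu : nat -> R) (x : nat -> W),
    [/\ forall n, 0 < nu n, nu n @[n --> \oo] --> (0 : R),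
        forall n, X (x n) & nu n *: x n @[n --> \oo] --> z].
Proof.
move=> h.
have /choice[f fP] n : exists q : R * W, [/\ 0 < q.1,
    q.1 <= (`|z| + 1) * n.+1%:R^-1, X q.2 & `|z - q.1 *: q.2| < n.+1%:R^-1].
  have n0 : 0 < n.+1%:R^-1 :> R by rewrite invr_gt0.
  (* The cone generated by the ball, written as a union of preimages so that
     its openness is immediate. *)
  pose G := \bigcup_(t in [set t : R | 0 < t])
    ((fun v : W => t *: v) @^-1` ball z n.+1%:R^-1).
  have [|x [[t /= t0 zx] Xx] nx] := (unboundedP (G `&` X)).1 _ n.+1%:R.
    apply: h.
    + apply: bigcup_open => t _; apply: open_comp; last exact: ball_open.
      by move=> v _; exact: scaler_continuous.
    + move=> s v s0 [t /= t0 zv]; exists (t / s); first exact: divr_gt0.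
      by rewrite /= scalerA divfK ?gt_eqF.
    + by exists 1 => //=; rewrite scale1r; exact: ballxx.
  (* Since n.+1 < |x| while |t *: x| <= |z| + 1, the scalar t is small. *)
  exists (t, x); split=> //=; last by move: zx; rewrite -ball_normE.
  rewrite ler_pdivlMr ?ltr0n //.
  have le1 : n.+1%:R^-1 <= 1 :> R by rewrite invf_le1 ?ler1n ?ltr0n.
  apply: le_trans (_ : `|t *: x| <= _).
    by rewrite normrZ gtr0_norm // ler_pM2l // ltW.
  rewrite -lerBlDl; apply: le_trans (lerB_dist _ _) _.
  rewrite distrC; apply: le_trans le1; apply: ltW.
  by move: zx; rewrite -ball_normE.
have inv0 : (fun n => n.+1%:R^-1 : R) @ \oo --> (0 : R) by exact: cvg_harmonic.
exists (fst \o f), (snd \o f); split=> [n||n|] /=; try by case: (fP n).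
  apply: (@squeeze_cvgr _ _ _ _ (fun=> 0) (fun n => (`|z| + 1) * n.+1%:R^-1)).
  - by apply: nearW => n; have [/ltW -> ->] := fP n.
  - exact: cvg_cst.
  - by rewrite -[X in _ --> X](mulr0 (`|z| + 1)); apply: cvgMr.
apply/cvgrPdist_lt => e e0.
have /cvgrPdist_lt/(_ e e0) := inv0.
apply: filterS => n; rewrite sub0r normrN gtr0_norm ?invr_gt0 //.
by apply: lt_trans; case: (fP n).
Qed.

(** The points (nu *: x, nu) converge to (z, 0) and lie on the rays of the
points (x, 1). *)
Lemma seq_real_cone (z : W) (nu : nat -> R) (x : nat -> W) : z != 0 ->
  (forall n, 0 < nu n) -> nu n @[n --> \oo] --> (0 : R) ->
  (forall n, X (x n)) -> nu n *: x n @[n --> \oo] --> z ->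
  real_asymptotic_cone X z.
Proof.
move=> z0 nu0 nuc Xx xc; apply/real_asymptotic_coneP => // N oN cN Nz.
have pc : (nu n *: x n, nu n : R^o) @[n --> \oo] --> (z, 0 : R^o).
  exact: (cvg_pair xc nuc).
have [n _ /(_ n (leqnn n)) /= Nn] := pc _ (open_nbhs_nbhs (conj oN Nz)).
exists (x n) => //.
have -> : (x n, 1 : R^o) = (nu n)^-1 *: (nu n *: x n, nu n : R^o).
  transitivity ((nu n)^-1 *: (nu n *: x n), (nu n)^-1 * nu n : R^o) => //.
  by rewrite scalerA mulVf ?scale1r ?gt_eqF.
by apply: cN => //; rewrite invr_gt0.
Qed.

Lemma real_asymptotic_cone_seqP (z : W) : z != 0 ->
  real_asymptotic_cone X z <->
  exists (nu : nat -> R) (x : nat -> W),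
    [/\ forall n, 0 < nu n, nu n @[n --> \oo] --> (0 : R),
        forall n, X (x n) & nu n *: x n @[n --> \oo] --> z].
Proof.
move=> z0; split=> [Xz|[nu [x [nu0 nuc Xx xc]]]].
  by apply: unbounded_seq => G; exact: real_cone_unbounded.
exact: (seq_real_cone z0 nu0 nuc Xx xc).
Qed.

Lemma real_asymptotic_cone_unboundedP (z : W) : z != 0 ->
  real_asymptotic_cone X z <->
  forall G : set W, open G -> positive_cone G -> G z ->
    ~ bounded_set (G `&` X).
Proof.
move=> z0; split=> [Xz G|/unbounded_seq]; first exact: real_cone_unbounded.
exact: (real_asymptotic_cone_seqP z0).2.
Qed.

End Cone.
End RealCone.

(** * Continuity of linear bijections onto R^n *)

Lemma continuous_linear_rV (R : realType) (W : normedModType R) (n : nat)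
  (f : {linear 'rV[R]_n -> W}) : continuous f.
Proof.
have fE : f =1 fun a => \sum_(i < n) a ord0 i *: f (delta_mx ord0 i).
  move=> a; rewrite [in LHS](row_sum_delta a) linear_sum.
  by apply: eq_bigr => i _; rewrite linearZ.
move=> a; rewrite /continuous_at [X in _ --> X]fE; under eq_cvg do rewrite fE.
have Fa : Filter (nbhs a) := nbhs_filter a.
apply: (@cvg_big W 'I_n +%R 0 xpredT (@add_continuous W) _ (nbhs a) _
  (fun i b => b ord0 i *: f (delta_mx ord0 i)) _ Fa) => i _.
by apply: cvgZr_tmp; exact: coord_continuous.
Qed.

(** The inverse h of f is continuous and does not vanish on the unit sphere of
R^n; by compactness |h| has a positive minimum m there, and |f w| <= |w| / m. *)
Lemma linear_bij_rV_continuous (R : realType) (W : normedModType R) (n : nat)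
  (f : {linear W -> 'rV[R]_n}) : bijective f -> continuous f.
Proof.
move=> [g fK gK].
have lg : linear g := can2_linear fK gK.
pose h : {linear 'rV[R]_n -> W} := HB.pack g (GRing.isLinear.Build _ _ _ _ g lg).
have hc : continuous h by exact: continuous_linear_rV.
pose S := [set a : 'rV[R]_n | `|a| = 1].
suff [m m0 hm] : exists2 m, 0 < m & forall a, S a -> m <= `|h a|.
  apply/linear_bounded_continuous/linear_boundedP; near=> M => w.
  have [->|w0] := eqVneq (f w) 0; first by rewrite normr0 mulr_ge0.
  have Sa : S (`|f w|^-1 *: f w).
    by rewrite /S /= normrZ normfV normr_id mulVf ?normr_eq0.
  have := hm _ Sa; rewrite linearZ /= fK normrZ normfV normr_id.
  rewrite mulrC ler_pdivlMr ?normr_gt0 // mulrC -ler_pdivlMr //.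
  move=> /le_trans; apply.
  by rewrite mulrC ler_wpM2r.
(* The sphere is empty when n = 0. *)
have [S0|/set0P S0] := eqVneq S set0; first by exists 1 => // a; rewrite S0.
have cS : compact S.
  apply: bounded_closed_compact.
    by exists 1; split=> // M M1 a Sa; rewrite /= Sa ltW.
  rewrite (_ : S = Num.norm @^-1` [set 1]) //.
  by apply: closed_comp => [a _|]; [exact: norm_continuous | exact: closed_eq].
have [|c cS' cmin] := @compact_EVT_min _ R (fun a => `|h a|) S S0 cS.
  by apply: continuous_subspaceT => a; exact: (cvg_norm (hc a)).
exists `|h c|; last by move=> a Sa; apply: cmin; exact/mem_set.
rewrite normr_gt0; apply/eqP => hc0.
have c0 : c = 0 by rewrite -[c]gK [g c]hc0 linear0.
by have := set_mem cS'; rewrite /S /= c0 normr0 => /eqP; rewrite eq_sym oner_eq0.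
Unshelve. all: by end_near. Qed.

(** * Limits of polynomials and of complex numbers *)

Lemma cvg_meval (K : numFieldType) (n : nat) (p : mpoly n K)
  (u : 'I_n -> nat -> K) (l : 'I_n -> K) :
  (forall i, u i m @[m --> \oo] --> l i) ->
  meval (u ^~ m) p @[m --> \oo] --> meval l p.
Proof.
move=> ul; rewrite mevalE; under eq_cvg do rewrite mevalE.
apply: cvg_big => [|m _]; first exact: add_continuous.
apply: cvgMl_tmp; apply: cvg_big => [|i _]; first exact: mul_continuous.
elim: (m i) => [|k IH]; first by under eq_cvg do rewrite expr0; exact: cvg_cst.
by rewrite exprS; under eq_cvg do rewrite exprS; exact: cvgM.
Qed.

(** The topology of a numFieldType is attached to the structure, not to the
type R[i]; naming the structure lets limits in R[i] be stated. *)
Definition complex_field (R : realType) : numFieldType := R[i].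

Lemma cvg_complex (R : realType) (u : nat -> complex_field R)
    (l : complex_field R) :
  complex.Re (u n) @[n --> \oo] --> complex.Re l ->
  complex.Im (u n) @[n --> \oo] --> complex.Im l ->
  u n @[n --> \oo] --> l.
Proof.
have cC (v : nat -> R) (a : R) : v n @[n --> \oo] --> a ->
    (real_complex R (v n) : complex_field R) @[n --> \oo] -->
    (real_complex R a : complex_field R).
  move=> /cvgrPdist_lt va; apply/cvgrPdist_lt => e.
  rewrite ltcE /= => /andP[/eqP e0 Re0].
  apply: filterS (va _ Re0) => n ne.
  by rewrite -rmorphB normc_def /= expr0n /= addr0 sqrtr_sqr ltcE /= e0 eqxx.
move=> cRe cIm; pose C := complex_field R.
have zE (z : C) :
    z = (real_complex R (complex.Re z) : C) +
        ('i%C : C) * (real_complex R (complex.Im z) : C).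
  exact: complexE.
rewrite (zE l); under eq_cvg => n do rewrite (zE (u n)).
by apply: cvgD; [exact: cC | apply: cvgMl_tmp; exact: cC].
Qed.

(** * Polynomials on the projective completion *)

Section ProjectiveCompletion.
Variables (K : fieldType) (E : vectType K).

Lemma poly_eval_scale (p : coord_poly (E * K^o)%type) (t : K) (v : E) :
  homogeneous p -> t != 0 -> poly_eval p (v, 1) = 0 ->
  poly_eval p (t *: v, t : K^o) = 0.
Proof.
move=> hp t0.
have q0 : (t *: v, t : K^o) <> (0 : E * K^o).
  by move=> /(congr1 snd) /eqP; exact/negP.
pose q : nonzero (E * K^o)%type := nonzero_of q0.
suff lines : proj_class (pair1 K v) = proj_class q.
  exact: (homogeneous_eval_line hp lines).
apply/eqmodP/asboolP; exists t => //=.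
transitivity (t *: v, t * 1 : K^o) => //.
by rewrite mulr1.
Qed.

(** The coordinates on E (+) K restricted to the hyperplane at infinity: being
linear on E, they are within the reach of continuity results about E. *)
Definition coord0 i (v : E) : K^o := coord (vbasis {:(E * K^o)%type}) i (v, 0).

Lemma coord0_linear i : linear (coord0 i).
Proof.
move=> a u v; rewrite /coord0.
have -> : (a *: u + v, 0 : K^o) = a *: ((u, 0) : E * K^o) + (v, 0).
  transitivity (a *: u + v, a * 0 + 0 : K^o) => //.
  by rewrite mulr0 addr0.
by rewrite linearD linearZ.
Qed.
HB.instance Definition _ i :=
  GRing.isLinear.Build K E K^o _ (coord0 i) (coord0_linear i).

Lemma coord_pairE i (v : E) (t : K^o) :
  coord (vbasis {:(E * K^o)%type}) i (v, t) =
  coord0 i v + t * coord (vbasis {:(E * K^o)%type}) i (0, 1).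
Proof.
have -> : (v, t) = ((v, 0) : E * K^o) + t *: ((0, 1) : E * K^o).
  transitivity (v + t *: 0, 0 + t * 1 : K^o) => //.
  by rewrite scaler0 addr0 add0r mulr1.
by rewrite linearD linearZ.
Qed.

(** Zariski closed sets being zero loci of homogeneous polynomials, membership
in the cone is tested on the polynomials vanishing on X, and one
representative of each line is enough. *)
Lemma asymptotic_cone_poly (X : set E) (v : E) :
  v != 0 ->
  (forall p : coord_poly (E * K^o)%type, homogeneous p ->
     (forall x, X x -> poly_eval p (x, 1) = 0) -> poly_eval p (v, 0) = 0) ->
  asymptotic_cone X v.
Proof.
move=> /eqP v0 h; pose v' := nonzero_of v0.
right; exists v' => //; split; last by exists (proj_class v').
rewrite kappaE closureE => C [/zariski_closedP[S hS ->] XS] p Sp u uv.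
apply: (homogeneous_eval_line (hS _ Sp) (esym uv)).
apply: h => [|x Xx]; first exact: hS.
by apply: (XS (Defs.iota x) _ p Sp (pair1 K x)) => //; exists x.
Qed.

End ProjectiveCompletion.

(** * Real forms *)

Section RealForm.
Variables (R : realType) (V : vectType R[i]) (VR : normedModType R).
Variable j : {linear VR -> V | real_complex R \; *:%R}.

Definition complexify (p : VR * VR) : V := j p.1 + 'i%C *: j p.2.

(** The real and imaginary parts of the complex coordinates of V. *)
Definition real_coord (p : VR * VR) :=
  row_mx (map_mx (@complex.Re R) (v2r (complexify p)))
         (map_mx (@complex.Im R) (v2r (complexify p))).

Lemma complexify_linear a p q :
  complexify (a *: p + q) = real_complex R a *: complexify p + complexify q.
Proof.
rewrite /complexify /= !linearP /= !scalerDr !scalerA [_ * 'i%C]mulrC.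
by rewrite -!addrA; congr (_ + _); rewrite addrCA.
Qed.

Lemma real_coord_linear : linear real_coord.
Proof.
move=> a p q; rewrite /real_coord complexify_linear linearP.
rewrite -[RHS]/(_ *: row_mx _ _ + _) scale_row_mx add_row_mx.
congr row_mx; apply/rowP => i; rewrite !mxE;
  case: (v2r (complexify p) 0 i) => x y;
  case: (v2r (complexify q) 0 i) => x' y' /=.
  by rewrite mul0r subr0.
by rewrite mul0r addr0.
Qed.

Hypothesis hj : real_form j.

Lemma real_form_inj : injective j.
Proof.
move=> u v juv; have [p [_ pu]] := hj (j u).
have := pu (u, 0); have := pu (v, 0).
rewrite /= !raddf0 !addr0 => -> // vu.
by have := vu erefl; case.
Qed.

Lemma real_coord_bij : bijective real_coord.
Proof.
have /choice[P PP] : forall v, exists p, v = complexify p.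
  by move=> v; have [p [vp _]] := hj v; exists p.
have complexify_inj p q : complexify p = complexify q -> p = q.
  move=> pq; have [r [_ ru]] := hj (complexify p).
  by rewrite -(ru p erefl) (ru q pq).
exists (fun r => P (r2v (\row_k Complex (lsubmx r ord0 k) (rsubmx r ord0 k)))).
  move=> p; apply: complexify_inj; rewrite -PP row_mxKl row_mxKr.
  apply: (can_inj v2rK); rewrite r2vK; apply/rowP => k; rewrite !mxE.
  by case: (v2r _ _ _).
move=> r; rewrite /real_coord -PP r2vK -[RHS]hsubmxK.
by congr row_mx; apply/rowP => k; rewrite !mxE.
Qed.

(** Complex linear functionals are continuous on the real form: real_coord is
continuous as a linear bijection onto a space R^n, and phi is a linear
combination of the complex coordinates. *)
Lemma real_form_cvg (phi : {linear V -> R[i]^o}) (w : nat -> VR) (z : VR) :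
  w n @[n --> \oo] --> z ->
  (phi (j (w n)) : complex_field R) @[n --> \oo] -->
  (phi (j z) : complex_field R).
Proof.
move=> wz.
pose L : {linear (VR * VR)%type -> 'rV[R]_(_)} :=
  HB.pack real_coord (GRing.isLinear.Build _ _ _ _ real_coord real_coord_linear).
have cL : continuous L by apply: linear_bij_rV_continuous; exact: real_coord_bij.
have Lw : L (w n, 0) @[n --> \oo] --> L (z, 0).
  apply: continuous_cvg; first exact: cL.
  exact: (cvg_pair wz (cvg_cst (0 : VR))).
have Lwk k : L (w n, 0) ord0 k @[n --> \oo] --> L (z, 0) ord0 k.
  exact: (continuous_cvg _ (@coord_continuous _ _ _ _ _ _) Lw).
have cE v : complexify (v, 0) = j v.
  by rewrite /complexify /= raddf0 scaler0 addr0.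
have vk k : (v2r (j (w n)) ord0 k : complex_field R) @[n --> \oo] -->
    (v2r (j z) ord0 k : complex_field R).
  apply: cvg_complex.
    have := Lwk (lshift _ k).
    rewrite /= /real_coord row_mxEl mxE cE.
    by under eq_cvg do rewrite row_mxEl mxE cE.
  have := Lwk (rshift _ k).
  rewrite /= /real_coord row_mxEr mxE cE.
  by under eq_cvg do rewrite row_mxEr mxE cE.
have phiE v : phi v =
    \sum_k v2r v ord0 k * phi (r2v (delta_mx ord0 k)) :> complex_field R.
  rewrite -[in LHS](v2rK v) [in LHS](row_sum_delta (v2r v)) !linear_sum.
  by apply: eq_bigr => k _; rewrite !linearZ.
rewrite phiE; under eq_cvg do rewrite phiE.
apply: cvg_big => [|k _]; first exact: add_continuous.
by apply: cvgMr_tmp.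
Qed.

(** A homogeneous polynomial vanishing on the image of X vanishes along
(nu_n x_n, nu_n), hence at the limit (z, 0). *)
Lemma real_cone_sub (X : set VR) (z : VR) : z != 0 ->
  real_asymptotic_cone X z -> asymptotic_cone (j @` X) (j z).
Proof.
move=> z0 Xz.
have [nu [x [nu0 nuc Xx xc]]] := (real_asymptotic_cone_seqP X z0).1 Xz.
apply: asymptotic_cone_poly.
  by rewrite -(raddf0 j) (inj_eq real_form_inj).
move=> p hp p0.
have p0n n : poly_eval p (j (nu n *: x n), real_complex R (nu n)) = 0.
  rewrite linearZ; apply: poly_eval_scale => //.
    by rewrite fmorph_eq0 gt_eqF.
  by apply: p0; exists (x n).
pose C := complex_field R.
have cvg_coord i :
    (coord (vbasis {:(V * R[i]^o)%type}) i
       (j (nu n *: x n), real_complex R (nu n)) : C) @[n --> \oo] -->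
    (coord (vbasis {:(V * R[i]^o)%type}) i (j z, 0) : C).
  pose c := coord (vbasis {:(V * R[i]^o)%type}) i (0, 1) : C.
  have nuC : (real_complex R (nu n) * c : C) @[n --> \oo] --> (0 * c : C).
    by apply: (@cvgMr_tmp C); apply: cvg_complex => //=; exact: cvg_cst.
  have sumC :
      ((coord0 i (j (nu n *: x n)) : C) + (real_complex R (nu n) * c : C))
      @[n --> \oo] --> (coord0 i (j z) : C) + (0 * c : C).
    exact: (cvgD (real_form_cvg (phi := coord0 i) xc) nuC).
  rewrite coord_pairE; under eq_cvg do rewrite coord_pairE.
  exact: sumC.
have := @cvg_meval C _ p _ _ cvg_coord.
rewrite (_ : (fun m => _) = fun=> (0 : C)); last first.
  by apply/funext => n; exact: p0n.
by move=> /(cvg_unique (@norm_hausdorff _ _) (cvg_cst _)) /esym.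
Qed.

End RealForm.

Theorem proposition4p4 (R : realType) (V : vectType R[i])
    (VR : normedModType R) (j : {linear VR -> V | real_complex R \; *:%R})
    (hj : real_form j) :
  (forall X : set VR,
     j @` real_asymptotic_cone X `<=` asymptotic_cone (j @` X))
  /\
  (forall X : set VR,
     (forall z : VR, z != 0 ->
        (real_asymptotic_cone X z <->
         exists (nu : nat -> R) (x : nat -> VR),
           [/\ forall n, 0 < nu n,
               nu n @[n --> \oo] --> (0 : R),
               forall n, X (x n) &
               nu n *: x n @[n --> \oo] --> z])
        /\
        (real_asymptotic_cone X z <->
         forall G : set VR, open G -> positive_cone G -> G z ->
           ~ bounded_set (G `&` X)))
     /\
     hho_asymptotic_cone X = real_asymptotic_cone X).
Proof.
split=> [X _ [z Xz <-]|X].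
  have [->|z0] := eqVneq z 0; first by left; rewrite /= raddf0.
  exact: real_cone_sub.
split=> [z z0|].
  split; first exact: real_asymptotic_cone_seqP.
  exact: real_asymptotic_cone_unboundedP.
apply/seteqP; split=> z; have [->|z0] := eqVneq z 0.
- by left.
- by move=> [/(real_asymptotic_cone_unboundedP X z0)//|z00]; left.
- by right.
- by move=> /(real_asymptotic_cone_unboundedP X z0); left.
Qed.
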